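(* Let $\mathcal{C}$ be a duoidal category with structure $(\circ,I,\bullet,J,\zeta,\delta,\varpi,\tau)$, having equalizers and such that every object of $\mathcal{C}^\bullet=(\mathcal{C},\bullet,J)$ is flat. Let $C,D$ be coalgebras in $\mathcal{C}^\bullet$ such that the functors $-\bullet C:\mathcal{C}\to\mathcal{C}^C$ and $-\bullet D:\mathcal{C}\to\mathcal{C}^D$ are semiseparable (resp., naturally full). Suppose $\varpi:J\circ J\to J$ is a split-mono. Then $-\bullet(C\circ D):\mathcal{C}\to\mathcal{C}^{C\circ D}$ is semiseparable (resp., naturally full).
   Context: A duoidal category is a category $\mathcal{C}$ with two monoidal structures $\mathcal{C}^\circ=(\mathcal{C},\circ,I)$ and $\mathcal{C}^\bullet=(\mathcal{C},\bullet,J)$, a natural transformation $\zeta_{A,B,C,D}:(A\bullet B)\circ(C\bullet D)\to(A\circ C)\bullet(B\circ D)$ and morphisms $\delta:I\to I\bullet I$, $\varpi:J\circ J\to J$, $\tau:I\to J$ such that $(J,\varpi,\tau)$ is an algebra in $\mathcal{C}^\circ$, $(I,\delta,\tau)$ is a coalgebra in $\mathcal{C}^\bullet$, and (associativity constraints suppressed, composition written by juxtaposition, $l^\circ,r^\circ,l^\bullet,r^\bullet$ the unit constraints) $\zeta_{A,B,C\circ E,D\circ F}(\mathrm{Id}_{A\bullet B}\circ\zeta_{C,D,E,F})=\zeta_{A\circ C,B\circ D,E,F}(\zeta_{A,B,C,D}\circ\mathrm{Id}_{E\bullet F})$, $(\mathrm{Id}_{A\circ D}\bullet\zeta_{B,C,E,F})\zeta_{A,B\bullet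 C,D,E\bullet F}=(\zeta_{A,B,D,E}\bullet\mathrm{Id}_{C\circ F})\zeta_{A\bullet B,C,D\bullet E,F}$, $(l^\circ_A\bullet l^\circ_B)\zeta_{I,I,A,B}(\delta\circ\mathrm{Id}_{A\bullet B})=l^\circ_{A\bullet B}$, $(r^\circ_A\bullet r^\circ_B)\zeta_{A,B,I,I}(\mathrm{Id}_{A\bullet B}\circ\delta)=r^\circ_{A\bullet B}$, $l^\bullet_{A\circ B}(\varpi\bullet\mathrm{Id}_{A\circ B})\zeta_{J,A,J,B}=l^\bullet_A\circ l^\bullet_B$, $r^\bullet_{A\circ B}(\mathrm{Id}_{A\circ B}\bullet\varpi)\zeta_{A,J,B,J}=r^\bullet_A\circ r^\bullet_B$. For coalgebras $(C,\Delta_C,\varepsilon_C)$, $(D,\Delta_D,\varepsilon_D)$ in $\mathcal{C}^\bullet$, $C\circ D$ is a coalgebra in $\mathcal{C}^\bullet$ with comultiplication $\zeta_{C,C,D,D}(\Delta_C\circ\Delta_D)$ and counit $\varpi(\varepsilon_C\circ\varepsilon_D)$. For a coalgebra $C$ in $\mathcal{C}^\bullet$, $\mathcal{C}^C$ is the category of right $C$-comodules in $\mathcal{C}^\bullet$, and $-\bullet C:\mathcal{C}\to\mathcal{C}^C$ sends $M$ to $M\bullet C$ with coaction $\mathrm{Id}_M\bullet\Delta_C$. An object $X$ of $\mathcal{C}^\bullet$ is flat if $X\bullet-$ and $-\bullet X$ preserve equalizers. A functor $F:\mathcal{A}\to\mathcal{B}$ induces the natural transformation $\mathcal{F}:\mathrm{Hom}_{\mathcal{A}}(-,-)\to\mathrm{Hom}_{\mathcal{B}}(F-,F-)$,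 $f\mapsto F(f)$. $F$ is naturally full (resp. semiseparable) if there is a natural transformation $\mathcal{P}:\mathrm{Hom}_{\mathcal{B}}(F-,F-)\to\mathrm{Hom}_{\mathcal{A}}(-,-)$ such that $\mathcal{P}$ followed by $\mathcal{F}$ is the identity (resp. $\mathcal{F}$ followed by $\mathcal{P}$ followed by $\mathcal{F}$ equals $\mathcal{F}$). *)

(* Defs.v *)
From Stdlib Require Import ssreflect ProofIrrelevance.

(** * Categories and functors *)

Record Category := {
  ob :> Type;
  hom : ob -> ob -> Type;
  idm : forall A, hom A A;
  comp : forall {X Y Z}, hom Y Z -> hom X Y -> hom X Z;
  comp_idl : forall X Y (f : hom X Y), comp (idm Y) f = f;
  comp_idr : forall X Y (f : hom X Y), comp f (idm X) = f;
  compA : forall X Y Z W (h : hom Z W) (g : hom Y Z) (f : hom X Y),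
    comp h (comp g f) = comp (comp h g) f
}.

Arguments hom {_} _ _.
Arguments idm {_} _.
Arguments comp {_ X Y Z} _ _.
Arguments comp_idl {_ X Y} _.
Arguments comp_idr {_ X Y} _.
Arguments compA {_ X Y Z W} _ _ _.

Notation "g \o f" := (comp g f) (at level 50, left associativity).

Record Functor (A B : Category) := {
  fob :> A -> B;
  fmap : forall {X Y : A}, hom X Y -> hom (fob X) (fob Y);
  fmap_id : forall X : A, fmap (idm X) = idm (fob X);
  fmap_comp : forall (X Y Z : A) (g : hom Y Z) (f : hom X Y),
    fmap (g \o f) = fmap g \o fmap f
}.

Arguments fob {A B} _ _.
Arguments fmap {A B} _ {X Y} _.

Definition split_mono {A : Category} {X Y : A} (f : hom X Y) : Prop :=
  exists s : hom Y X, s \o f = idm X.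

Definition is_equalizer {A : Category} {X Y E : A}
    (f g : hom X Y) (e : hom E X) : Prop :=
  f \o e = g \o e /\
  forall (Z : A) (h : hom Z X), f \o h = g \o h ->
    exists! u : hom Z E, e \o u = h.

Definition has_equalizers (A : Category) : Prop :=
  forall (X Y : A) (f g : hom X Y),
    exists (E : A) (e : hom E X), is_equalizer f g e.

Definition preserves_equalizers {A B : Category} (F : Functor A B) : Prop :=
  forall (X Y E : A) (f g : hom X Y) (e : hom E X),
    is_equalizer f g e -> is_equalizer (fmap F f) (fmap F g) (fmap F e).

(* Naturality, in both variables, of a family Hom_B(F-, F-) -> Hom_A(-, -)
   of functors A^op x A -> Set. *)
Definition hom_natural {A B : Category} (F : Functor A B)
    (P : forall X Y : A, hom (F X) (F Y) -> hom X Y) : Prop :=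
  forall (X X' Y Y' : A) (h : hom X' X) (k : hom Y Y') (g : hom (F X) (F Y)),
    P X' Y' (fmap F k \o g \o fmap F h) = k \o P X Y g \o h.

Definition semiseparable {A B : Category} (F : Functor A B) : Prop :=
  exists P : forall X Y : A, hom (F X) (F Y) -> hom X Y,
    hom_natural F P /\
    forall (X Y : A) (f : hom X Y), fmap F (P X Y (fmap F f)) = fmap F f.

Definition naturally_full {A B : Category} (F : Functor A B) : Prop :=
  exists P : forall X Y : A, hom (F X) (F Y) -> hom X Y,
    hom_natural F P /\
    forall (X Y : A) (g : hom (F X) (F Y)), fmap F (P X Y g) = g.

(** * Monoidal categories *)

Record Monoidal (C : Category) := {
  tens : C -> C -> C;
  tensm : forall {A A' B B' : C},
    hom A A' -> hom B B' -> hom (tens A B) (tens A' B');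
  tensm_id : forall A B, tensm (idm A) (idm B) = idm (tens A B);
  tensm_comp : forall (A A' A'' B B' B'' : C)
      (f' : hom A' A'') (f : hom A A') (g' : hom B' B'') (g : hom B B'),
    tensm (f' \o f) (g' \o g) = tensm f' g' \o tensm f g;
  munit : C;
  assoc : forall A B D, hom (tens (tens A B) D) (tens A (tens B D));
  assoc_inv : forall A B D, hom (tens A (tens B D)) (tens (tens A B) D);
  assocK : forall A B D, assoc_inv A B D \o assoc A B D = idm _;
  assoc_invK : forall A B D, assoc A B D \o assoc_inv A B D = idm _;
  lunit : forall A, hom (tens munit A) A;
  lunit_inv : forall A, hom A (tens munit A);
  lunitK : forall A, lunit_inv A \o lunit A = idm _;
  lunit_invK : forall A, lunit A \o lunit_inv A = idm _;
  runit : forall A, hom (tens A munit) A;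
  runit_inv : forall A, hom A (tens A munit);
  runitK : forall A, runit_inv A \o runit A = idm _;
  runit_invK : forall A, runit A \o runit_inv A = idm _;
  assoc_nat : forall (A A' B B' D D' : C)
      (f : hom A A') (g : hom B B') (h : hom D D'),
    assoc A' B' D' \o tensm (tensm f g) h =
    tensm f (tensm g h) \o assoc A B D;
  lunit_nat : forall (A A' : C) (f : hom A A'),
    lunit A' \o tensm (idm munit) f = f \o lunit A;
  runit_nat : forall (A A' : C) (f : hom A A'),
    runit A' \o tensm f (idm munit) = f \o runit A;
  triangle : forall A B,
    tensm (idm A) (lunit B) \o assoc A munit B = tensm (runit A) (idm B);
  pentagon : forall A B D E,
    assoc A B (tens D E) \o assoc (tens A B) D E =
    tensm (idm A) (assoc B D E) \o assoc A (tens B D) E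
      \o tensm (assoc A B D) (idm E)
}.

Arguments tens {C} _ _ _.
Arguments tensm {C} _ {A A' B B'} _ _.
Arguments tensm_id {C} _ _ _.
Arguments tensm_comp {C} _ {A A' A'' B B' B''} _ _ _ _.
Arguments munit {C} _.
Arguments assoc {C} _ _ _ _.
Arguments assoc_inv {C} _ _ _ _.
Arguments lunit {C} _ _.
Arguments runit {C} _ _.

Notation "A ⊗[ M ] B" := (tens M A B)
  (at level 40, left associativity, format "A  ⊗[ M ]  B").
Notation "f ⊠[ M ] g" := (tensm M f g)
  (at level 40, left associativity, format "f  ⊠[ M ]  g").

Section MonoidalTheory.
Context {C : Category} (M : Monoidal C).

Lemma tensm_id_comp (X A B D : C) (g : hom B D) (f : hom A B) :
  idm X ⊠[M] (g \o f) = (idm X ⊠[M] g) \o (idm X ⊠[M] f).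
Proof. by rewrite -tensm_comp comp_idl. Qed.

Lemma tensm_comp_id (X A B D : C) (g : hom B D) (f : hom A B) :
  (g \o f) ⊠[M] idm X = (g ⊠[M] idm X) \o (f ⊠[M] idm X).
Proof. by rewrite -tensm_comp comp_idl. Qed.

Definition tensor_left (X : C) : Functor C C :=
  {| fob := fun A => X ⊗[M] A;
     fmap := fun A B f => idm X ⊠[M] f;
     fmap_id := fun A => tensm_id M X A;
     fmap_comp := fun A B D g f => tensm_id_comp X A B D g f |}.

Definition tensor_right (X : C) : Functor C C :=
  {| fob := fun A => A ⊗[M] X;
     fmap := fun A B f => f ⊠[M] idm X;
     fmap_id := fun A => tensm_id M A X;
     fmap_comp := fun A B D g f => tensm_comp_id X A B D g f |}.

Definition flat (X : C) : Prop :=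
  preserves_equalizers (tensor_left X) /\ preserves_equalizers (tensor_right X).

Lemma assoc_epi (A B D X : C) (f g : hom (A ⊗[M] (B ⊗[M] D)) X) :
  f \o assoc M A B D = g \o assoc M A B D -> f = g.
Proof.
move=> e; have := f_equal (fun h => h \o assoc_inv M A B D) e.
by rewrite -!compA !assoc_invK !comp_idr.
Qed.

Lemma assoc_mono (A B D X : C) (f g : hom X ((A ⊗[M] B) ⊗[M] D)) :
  assoc M A B D \o f = assoc M A B D \o g -> f = g.
Proof.
move=> e; have := f_equal (fun h => assoc_inv M A B D \o h) e.
by rewrite !compA !assocK !comp_idl.
Qed.

Lemma assoc_inv_nat (A A' B B' D D' : C)
    (f : hom A A') (g : hom B B') (h : hom D D') :
  assoc_inv M A' B' D' \o (f ⊠[M] (g ⊠[M] h)) =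
  ((f ⊠[M] g) ⊠[M] h) \o assoc_inv M A B D.
Proof.
apply: assoc_mono; rewrite !compA assoc_invK comp_idl assoc_nat.
by rewrite -compA assoc_invK comp_idr.
Qed.

Lemma tensm_unit_inj (A B : C) (f g : hom A B) :
  f ⊠[M] idm (munit M) = g ⊠[M] idm (munit M) -> f = g.
Proof.
move=> e; have := f_equal (fun h => runit M B \o h \o runit_inv C M A) e.
by rewrite !runit_nat -!compA !runit_invK !comp_idr.
Qed.

Lemma runit_tens (A B : C) :
  (idm A ⊠[M] runit M B) \o assoc M A B (munit M) = runit M (A ⊗[M] B).
Proof.
apply: tensm_unit_inj; apply: assoc_mono.
rewrite tensm_comp_id compA assoc_nat -triangle tensm_id_comp.
rewrite -!compA [X in _ \o X]compA -pentagon compA -assoc_nat.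
by rewrite -compA tensm_id triangle.
Qed.

End MonoidalTheory.

(** * Algebras, coalgebras and comodules *)

Definition is_algebra {C : Category} (M : Monoidal C) (A : C)
    (mu : hom (A ⊗[M] A) A) (eta : hom (munit M) A) : Prop :=
  mu \o (mu ⊠[M] idm A) = mu \o (idm A ⊠[M] mu) \o assoc M A A A /\
  mu \o (eta ⊠[M] idm A) = lunit M A /\
  mu \o (idm A ⊠[M] eta) = runit M A.

Definition is_coalgebra {C : Category} (M : Monoidal C) (A : C)
    (Delta : hom A (A ⊗[M] A)) (eps : hom A (munit M)) : Prop :=
  assoc M A A A \o (Delta ⊠[M] idm A) \o Delta = (idm A ⊠[M] Delta) \o Delta /\
  lunit M A \o (eps ⊠[M] idm A) \o Delta = idm A /\
  runit M A \o (idm A ⊠[M] eps) \o Delta = idm A.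

Record Coalgebra {C : Category} (M : Monoidal C) := {
  cob :> C;
  comul : hom cob (cob ⊗[M] cob);
  counit : hom cob (munit M);
  coalgebraP : is_coalgebra M cob comul counit
}.

Arguments cob {C M} _.
Arguments comul {C M} _.
Arguments counit {C M} _.
Arguments coalgebraP {C M} _.

Section Comodules.
Context {C : Category} {M : Monoidal C} (D : Coalgebra M).

Record Comodule := {
  mob :> C;
  coact : hom mob (mob ⊗[M] D);
  coact_coassoc :
    assoc M mob D D \o (coact ⊠[M] idm (cob D)) \o coact =
    (idm mob ⊠[M] comul D) \o coact;
  coact_counit :
    runit M mob \o (idm mob ⊠[M] counit D) \o coact = idm mob
}.

Record ComoduleHom (N P : Comodule) := {
  cmap :> hom (mob N) (mob P);
  cmap_colinear : coact P \o cmap = (cmap ⊠[M] idm (cob D)) \o coact N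
}.

Arguments cmap {N P} _.

Lemma ComoduleHom_eq (N P : Comodule) (f g : ComoduleHom N P) :
  cmap f = cmap g -> f = g.
Proof.
case: f g => [f hf] [g hg] /= e; subst g.
by rewrite (proof_irrelevance _ hf hg).
Qed.

Lemma id_colinear (N : Comodule) :
  coact N \o idm (mob N) = (idm (mob N) ⊠[M] idm (cob D)) \o coact N.
Proof. by rewrite tensm_id comp_idl comp_idr. Qed.

Lemma comp_colinear (N P Q : Comodule)
    (g : ComoduleHom P Q) (f : ComoduleHom N P) :
  coact Q \o (cmap g \o cmap f) =
  ((cmap g \o cmap f) ⊠[M] idm (cob D)) \o coact N.
Proof.
by rewrite compA cmap_colinear -compA cmap_colinear compA tensm_comp_id.
Qed.

Definition ComoduleCat : Category.
Proof.
refine {| ob := Comodule; hom := ComoduleHom;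
  idm := fun N => {| cmap := idm (mob N); cmap_colinear := id_colinear N |};
  comp := fun N P Q g f =>
    {| cmap := cmap g \o cmap f; cmap_colinear := comp_colinear N P Q g f |} |}.
- by move=> X Y f; apply: ComoduleHom_eq; apply: comp_idl.
- by move=> X Y f; apply: ComoduleHom_eq; apply: comp_idr.
- by move=> X Y Z W h g f; apply: ComoduleHom_eq; apply: compA.
Defined.

Definition cofree_coact (N : C) : hom (N ⊗[M] D) ((N ⊗[M] D) ⊗[M] D) :=
  assoc_inv M N D D \o (idm N ⊠[M] comul D).

Lemma cofree_coassoc (N : C) :
  assoc M (N ⊗[M] D) D D \o (cofree_coact N ⊠[M] idm (cob D)) \o cofree_coact N =
  (idm (N ⊗[M] D) ⊠[M] comul D) \o cofree_coact N.
Proof.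
have [aD _] := coalgebraP D.
rewrite /cofree_coact; apply: (assoc_mono M).
rewrite tensm_comp_id !compA pentagon -(tensm_id M N D) assoc_nat.
rewrite -[_ \o (assoc_inv M N D D ⊠[M] idm (cob D))]compA.
rewrite -tensm_comp_id assoc_invK tensm_id comp_idr.
rewrite -[_ \o ((idm N ⊠[M] comul D) ⊠[M] idm (cob D))]compA assoc_nat.
rewrite -!compA !(compA (assoc M _ _ _) (assoc_inv M _ _ _)) !assoc_invK !comp_idl.
by rewrite -!tensm_id_comp -aD compA.
Qed.

Lemma cofree_counit (N : C) :
  runit M (N ⊗[M] D) \o (idm (N ⊗[M] D) ⊠[M] counit D) \o cofree_coact N =
  idm (N ⊗[M] D).
Proof.
rewrite /cofree_coact -runit_tens -tensm_id.
rewrite -!compA (compA (idm N ⊠[M] idm (cob D) ⊠[M] counit D)) -assoc_inv_nat.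
rewrite -!compA [X in _ \o X]compA assoc_invK comp_idl -!tensm_id_comp.
by case: (coalgebraP D) => _ [_]; rewrite -compA => ->.
Qed.

Definition cofree_comodule (N : C) : Comodule :=
  {| mob := N ⊗[M] D; coact := cofree_coact N;
     coact_coassoc := cofree_coassoc N; coact_counit := cofree_counit N |}.

Lemma cofree_colinear (N P : C) (f : hom N P) :
  cofree_coact P \o (f ⊠[M] idm (cob D)) =
  ((f ⊠[M] idm (cob D)) ⊠[M] idm (cob D)) \o cofree_coact N.
Proof.
rewrite /cofree_coact -compA -tensm_comp comp_idl comp_idr.
rewrite compA -assoc_inv_nat tensm_id -compA -tensm_comp.
by rewrite comp_idl comp_idr.
Qed.

(* The functor - ⊗ D from C to the category of right D-comodules. *)
Definition cofree : Functor C ComoduleCat.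
Proof.
refine {| fob := cofree_comodule : C -> ComoduleCat;
  fmap := fun N P f =>
    {| cmap := f ⊠[M] idm (cob D) : hom (mob (cofree_comodule N))
                                        (mob (cofree_comodule P));
       cmap_colinear := cofree_colinear N P f |} |}.
- by move=> X; apply: ComoduleHom_eq; apply: tensm_id.
- by move=> X Y Z g f; apply: ComoduleHom_eq; apply: tensm_comp_id.
Defined.

End Comodules.

(** * Duoidal categories *)

(* [white] is the structure (∘, I) and [black] the structure (•, J).  Where
   the axioms are usually written with the associativity constraints
   suppressed, the latter are inserted here. *)
Record Duoidal (C : Category) := {
  white : Monoidal C;
  black : Monoidal C;
  zeta : forall A B X Y : C,
    hom ((A ⊗[black] B) ⊗[white] (X ⊗[black] Y))
        ((A ⊗[white] X) ⊗[black] (B ⊗[white] Y));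
  delta : hom (munit white) (munit white ⊗[black] munit white);
  varpi : hom (munit black ⊗[white] munit black) (munit black);
  tau : hom (munit white) (munit black);
  zeta_nat : forall (A A' B B' X X' Y Y' : C)
      (a : hom A A') (b : hom B B') (x : hom X X') (y : hom Y Y'),
    zeta A' B' X' Y' \o ((a ⊠[black] b) ⊠[white] (x ⊠[black] y)) =
    ((a ⊠[white] x) ⊠[black] (b ⊠[white] y)) \o zeta A B X Y;
  varpi_algebra : is_algebra white (munit black) varpi tau;
  delta_coalgebra : is_coalgebra black (munit white) delta tau;
  zeta_white_assoc : forall A B X Y E F : C,
    zeta A B (X ⊗[white] E) (Y ⊗[white] F)
      \o (idm (A ⊗[black] B) ⊠[white] zeta X Y E F)
      \o assoc white (A ⊗[black] B) (X ⊗[black] Y) (E ⊗[black] F) =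
    (assoc white A X E ⊠[black] assoc white B Y F)
      \o zeta (A ⊗[white] X) (B ⊗[white] Y) E F
      \o (zeta A B X Y ⊠[white] idm (E ⊗[black] F));
  zeta_black_assoc : forall A B X Y E F : C,
    (idm (A ⊗[white] Y) ⊠[black] zeta B X E F)
      \o zeta A (B ⊗[black] X) Y (E ⊗[black] F)
      \o (assoc black A B X ⊠[white] assoc black Y E F) =
    assoc black (A ⊗[white] Y) (B ⊗[white] E) (X ⊗[white] F)
      \o (zeta A B Y E ⊠[black] idm (X ⊗[white] F))
      \o zeta (A ⊗[black] B) X (Y ⊗[black] E) F;
  zeta_white_lunit : forall A B : C,
    (lunit white A ⊠[black] lunit white B)
      \o zeta (munit white) (munit white) A B
      \o (delta ⊠[white] idm (A ⊗[black] B)) =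
    lunit white (A ⊗[black] B);
  zeta_white_runit : forall A B : C,
    (runit white A ⊠[black] runit white B)
      \o zeta A B (munit white) (munit white)
      \o (idm (A ⊗[black] B) ⊠[white] delta) =
    runit white (A ⊗[black] B);
  zeta_black_lunit : forall A B : C,
    lunit black (A ⊗[white] B)
      \o (varpi ⊠[black] idm (A ⊗[white] B))
      \o zeta (munit black) A (munit black) B =
    lunit black A ⊠[white] lunit black B;
  zeta_black_runit : forall A B : C,
    runit black (A ⊗[white] B)
      \o (idm (A ⊗[white] B) ⊠[black] varpi)
      \o zeta A (munit black) B (munit black) =
    runit black A ⊠[white] runit black B
}.

Arguments white {C} _.
Arguments black {C} _.
Arguments zeta {C} _ _ _ _ _.
Arguments delta {C} _.
Arguments varpi {C} _.
Arguments tau {C} _.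

Section ProductCoalgebra.
Context {C : Category} {V : Duoidal C} (A B : Coalgebra (black V)).

Lemma white_is_coalgebra :
  is_coalgebra (black V) (A ⊗[white V] B)
    (zeta V A A B B \o (comul A ⊠[white V] comul B))
    (varpi V \o (counit A ⊠[white V] counit B)).
Proof.
have [aA [lA rA]] := coalgebraP A; have [aB [lB rB]] := coalgebraP B.
split; [|split].
- rewrite tensm_comp_id tensm_id_comp -(tensm_id (white V) A B).
  rewrite !compA -(compA _ _ (zeta V A A B B)) -zeta_nat.
  rewrite -(compA _ _ (zeta V A A B B)) -zeta_nat.
  rewrite !compA tensm_id -zeta_black_assoc.
  rewrite -!(compA (_ \o zeta _ _ _ _ _)) -!tensm_comp.
  by rewrite aA aB.
- rewrite tensm_comp_id -(tensm_id (white V) A B).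
  rewrite !compA -(compA _ _ (zeta V A A B B)) -zeta_nat.
  rewrite !compA tensm_id zeta_black_lunit -!tensm_comp.
  by rewrite lA lB tensm_id.
- rewrite tensm_id_comp -(tensm_id (white V) A B).
  rewrite !compA -(compA _ _ (zeta V A A B B)) -zeta_nat.
  rewrite !compA tensm_id zeta_black_runit -!tensm_comp.
  by rewrite rA rB tensm_id.
Qed.

Definition white_coalgebra : Coalgebra (black V) :=
  {| cob := A ⊗[white V] B;
     comul := zeta V A A B B \o (comul A ⊠[white V] comul B);
     counit := varpi V \o (counit A ⊠[white V] counit B);
     coalgebraP := white_is_coalgebra |}.

End ProductCoalgebra.

(* Main.v *)
(* The forgetful functor from D-comodules is left adjoint to - • D, with counit
   epsilon_X = r_X (X • eps_D) and unit the coaction.  By a Rafael-type argument,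
   - • D is semiseparable (resp. naturally full) iff there is a natural
   gamma_X : X -> X • D with epsilon gamma epsilon = epsilon
   (resp. gamma epsilon = Id), and evaluating gamma at J this amounts to a single
   morphism chi : J -> D with eps_D chi eps_D = eps_D (resp. chi eps_D = Id).
   If s is a retraction of varpi and chi_A, chi_B are such morphisms, then so is
   (chi_A ∘ chi_B) s, for the coalgebra A ∘ B with counit
   varpi (eps_A ∘ eps_B). *)
From Stdlib Require Import ssreflect.
Require Import Defs.

Section UnitConstraints.
Context {C : Category} (M : Monoidal C).

Lemma unit_tensm_inj (A B : C) (f g : hom A B) :
  idm (munit M) ⊠[M] f = idm (munit M) ⊠[M] g -> f = g.
Proof.
move=> e; have := f_equal (fun h => lunit M B \o h \o lunit_inv C M A) e.
by rewrite !lunit_nat -!compA !lunit_invK !comp_idr.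
Qed.

Lemma runit_mono (A B : C) (f g : hom A (B ⊗[M] munit M)) :
  runit M B \o f = runit M B \o g -> f = g.
Proof.
move=> e; have := f_equal (fun h => runit_inv C M B \o h) e.
by rewrite !compA !runitK !comp_idl.
Qed.

Lemma runit_inv_nat (A B : C) (f : hom A B) :
  (f ⊠[M] idm (munit M)) \o runit_inv C M A = runit_inv C M B \o f.
Proof.
apply: runit_mono.
by rewrite !compA runit_nat runit_invK -compA runit_invK comp_idl comp_idr.
Qed.

Lemma lunit_epi (A B : C) (f g : hom A B) :
  f \o lunit M A = g \o lunit M A -> f = g.
Proof.
move=> e; have := f_equal (fun h => h \o lunit_inv C M A) e.
by rewrite -!compA !lunit_invK !comp_idr.
Qed.

(** Naturality of [runit] at the morphism [runit M A] itself, which is then cancelled. *)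
Lemma runit_unit_tensm (A : C) :
  runit M (A ⊗[M] munit M) = runit M A ⊠[M] idm (munit M).
Proof. by apply: runit_mono; rewrite runit_nat. Qed.

(** Kelly's argument: tensored with the unit and precomposed with the associator, both sides become
    [runit M (munit M) ⊠[M] idm (munit M)], one by the triangle axiom, the other by [runit_tens]. *)
Lemma lunit_munit : lunit M (munit M) = runit M (munit M).
Proof.
apply: unit_tensm_inj; apply: (assoc_epi M).
by rewrite triangle runit_tens runit_unit_tensm.
Qed.

End UnitConstraints.

Section CofreeAdjunction.
Context {C : Category} {M : Monoidal C} (D : Coalgebra M).

Definition adj_counit (X : C) : hom (X ⊗[M] D) X :=
  runit M X \o (idm X ⊠[M] counit D).

Lemma adj_counit_nat (X Y : C) (f : hom X Y) :
  adj_counit Y \o (f ⊠[M] idm (cob D)) = f \o adj_counit X.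
Proof.
rewrite /adj_counit -compA -tensm_comp comp_idl comp_idr compA -runit_nat.
by rewrite -compA -tensm_comp comp_idl comp_idr.
Qed.

Lemma adj_counit_munit :
  adj_counit (munit M) = counit D \o lunit M D.
Proof. by rewrite /adj_counit -lunit_munit lunit_nat. Qed.

(** Triangle identity at a cofree comodule, from the right counit axiom. *)
Lemma adj_counit_coact (X : C) :
  adj_counit (X ⊗[M] D) \o cofree_coact D X = idm (X ⊗[M] D).
Proof. exact: cofree_counit. Qed.

(** The other triangle identity; it rests on the left counit axiom of [D]. *)
Lemma adj_counit_tensm_coact (X : C) :
  (adj_counit X ⊠[M] idm (cob D)) \o cofree_coact D X = idm (X ⊗[M] D).
Proof.
have [_ [lD _]] := coalgebraP D.
rewrite /adj_counit /cofree_coact tensm_comp_id -triangle -!compA.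
rewrite (compA (idm X ⊠[M] counit D ⊠[M] idm (cob D))) -assoc_inv_nat.
rewrite -!compA (compA (assoc _ _ _ _)) assoc_invK comp_idl.
by rewrite -!tensm_id_comp compA lD tensm_id.
Qed.

Lemma colinear_adjunct (X Y : C)
    (g : hom (cofree D X) (cofree D Y)) :
  ((adj_counit Y \o cmap D _ _ g) ⊠[M] idm (cob D)) \o cofree_coact D X
  = cmap D _ _ g.
Proof.
rewrite tensm_comp_id -compA.
have /= <- := cmap_colinear D _ _ g.
by rewrite compA adj_counit_tensm_coact comp_idl.
Qed.

(** The adjunction unit at a cofree comodule; its colinearity is coassociativity. *)
Definition coact_hom (X : C) : hom (cofree D X) (cofree D (X ⊗[M] D)).
Proof.
refine {| cmap := cofree_coact D X : hom (mob D (cofree_comodule D X))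
                               (mob D (cofree_comodule D (X ⊗[M] D))) |}.
apply: (assoc_mono M); rewrite /= [RHS]compA cofree_coassoc.
by rewrite {1}/cofree_coact !compA assoc_invK comp_idl.
Defined.

Lemma counit_coact_hom (X : C) :
  fmap (cofree D) (adj_counit X) \o coact_hom X = idm (cofree D X).
Proof. by apply: ComoduleHom_eq; exact: adj_counit_tensm_coact. Qed.

(** Morphisms out of [X ⊗[M] D] can be recovered because the counit there has the section
    [cofree_coact D X]. *)
Lemma cofree_faithful_counit (X Y : C) (f g : hom (X ⊗[M] D) Y) :
  fmap (cofree D) f = fmap (cofree D) g -> f = g.
Proof.
move=> /(f_equal (cmap D _ _)) /= e.
have := f_equal (fun h => adj_counit Y \o h \o cofree_coact D X) e.
by rewrite !adj_counit_nat -(compA f) -(compA g) adj_counit_coact !comp_idr.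
Qed.

Section FromRetraction.
Variable P : forall X Y : C, hom (cofree D X) (cofree D Y) -> hom X Y.
Hypothesis P_nat : hom_natural (cofree D) P.

Let gamma (X : C) : hom X (X ⊗[M] D) := P X (X ⊗[M] D) (coact_hom X).

Lemma adj_counit_gamma (X : C) :
  adj_counit X \o gamma X = P X X (idm (cofree D X)).
Proof.
have := P_nat X X (X ⊗[M] D) X (idm X) (adj_counit X) (coact_hom X).
by rewrite counit_coact_hom fmap_id comp_idr comp_idr => ->.
Qed.

Lemma semiseparable_section :
  (forall X Y (f : hom X Y),
     fmap (cofree D) (P X Y (fmap (cofree D) f)) = fmap (cofree D) f) ->
  forall X, adj_counit X \o gamma X \o adj_counit X = adj_counit X.
Proof.
move=> PF X; apply: cofree_faithful_counit.
rewrite adj_counit_gamma.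
(* By naturality, [P] of the identity composed with [adj_counit X] is [P] of the image of
   [adj_counit X]. *)
have := P_nat X (X ⊗[M] D) X X (adj_counit X) (idm X) (idm _).
by rewrite fmap_id !comp_idl => <-; exact: PF.
Qed.

(** Fullness makes [gamma X ⊠[M] idm (cob D)] the coaction, so naturality of the counit reduces the
    claim to a triangle identity. *)
Lemma naturally_full_inverse :
  (forall X Y (g : hom (cofree D X) (cofree D Y)),
     fmap (cofree D) (P X Y g) = g) ->
  forall X, gamma X \o adj_counit X = idm (X ⊗[M] D).
Proof.
move=> FP X; rewrite -adj_counit_nat.
have /(f_equal (cmap D _ _)) /= -> := FP _ _ (coact_hom X).
exact: adj_counit_coact.
Qed.

End FromRetraction.

Section FromPoint.
Variable chi : hom (munit M) D.

Definition point_section (X : C) : hom X (X ⊗[M] D) :=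
  (idm X ⊠[M] chi) \o runit_inv C M X.

Lemma point_section_nat (X Y : C) (f : hom X Y) :
  (f ⊠[M] idm (cob D)) \o point_section X = point_section Y \o f.
Proof.
rewrite /point_section -compA -runit_inv_nat !compA -!tensm_comp.
by rewrite !comp_idl !comp_idr.
Qed.

(** Rafael's formula: the first two factors form the transpose of [g] across the adjunction. *)
Definition point_retraction (X Y : C)
    (g : hom (cofree D X) (cofree D Y)) : hom X Y :=
  adj_counit Y \o cmap D _ _ g \o point_section X.

Lemma point_retraction_nat : hom_natural (cofree D) point_retraction.
Proof.
move=> X X' Y Y' h k g; rewrite /point_retraction /=.
rewrite -(compA k) -(compA _ (point_section X) h) -point_section_nat.
by rewrite 2!(compA k) -adj_counit_nat !compA.
Qed.

Lemma point_section_counit (X : C) :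
  point_section X \o adj_counit X = idm X ⊠[M] (chi \o counit D).
Proof.
rewrite /point_section /adj_counit -compA (compA (runit_inv _ _ _)).
by rewrite runitK comp_idl -tensm_id_comp.
Qed.

Lemma counit_point_section_counit (X : C) :
  counit D \o chi \o counit D = counit D ->
  adj_counit X \o point_section X \o adj_counit X = adj_counit X.
Proof.
move=> e; rewrite -compA point_section_counit /adj_counit -compA.
by rewrite -tensm_id_comp compA e.
Qed.

End FromPoint.

Lemma semiseparable_cofreeP :
  semiseparable (cofree D) <->
  exists chi : hom (munit M) D, counit D \o chi \o counit D = counit D.
Proof.
split=> [[P [P_nat PF]]|[chi e]].
  have := semiseparable_section P P_nat PF (munit M).
  set g := P _ _ _ => e.
  (* The point is [gamma] at the unit object, carried to [D] along [lunit M D]. *)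
  exists (lunit M D \o g); apply: (lunit_epi M).
  by rewrite -compA -adj_counit_munit (compA (counit D)) -adj_counit_munit.
exists (point_retraction chi); split; first exact: point_retraction_nat.
move=> X Y f.
have -> : point_retraction chi X Y (fmap (cofree D) f)
          = f \o (adj_counit X \o point_section chi X).
  by rewrite /point_retraction /= adj_counit_nat -compA.
rewrite fmap_comp.
suff -> : fmap (cofree D) (adj_counit X \o point_section chi X)
          = idm (cofree D X) by rewrite comp_idr.
(* On X • D the endomorphism epsilon gamma • D becomes trivial, because
   (epsilon • D) is split epi. *)
rewrite -[LHS]comp_idr -[X in _ \o X]counit_coact_hom compA -fmap_comp.
by rewrite counit_point_section_counit // counit_coact_hom.
Qed.

Lemma naturally_full_cofreeP :
  naturally_full (cofree D) <->
  exists chi : hom (munit M) D, chi \o counit D = idm (cob D).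
Proof.
split=> [[P [P_nat FP]]|[chi e]].
  have := naturally_full_inverse P FP (munit M).
  set g := P _ _ _ => e.
  exists (lunit M D \o g); apply: (lunit_epi M).
  by rewrite -!compA -adj_counit_munit e comp_idl comp_idr.
exists (point_retraction chi); split; first exact: point_retraction_nat.
move=> X Y g; apply: ComoduleHom_eq.
rewrite /point_retraction /= tensm_comp_id.
have gamma_counit : point_section chi X \o adj_counit X = idm (X ⊗[M] D).
  by rewrite point_section_counit e tensm_id.
(* Both sides are inverse to epsilon_X • D. *)
suff -> : point_section chi X ⊠[M] idm (cob D) = cofree_coact D X.
  have := colinear_adjunct X Y g; rewrite tensm_comp_id; exact.
rewrite -[RHS]comp_idl -(tensm_id M (X ⊗[M] D) D) -gamma_counit tensm_comp_id.
by rewrite -compA adj_counit_tensm_coact comp_idr.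
Qed.

End CofreeAdjunction.

Theorem proposition5p10 (C : Category) (V : Duoidal C)
    (C_eq : has_equalizers C)
    (C_flat : forall X : C, flat (black V) X)
    (A B : Coalgebra (black V))
    (varpi_split : split_mono (varpi V)) :
  (semiseparable (cofree A) -> semiseparable (cofree B) ->
     semiseparable (cofree (white_coalgebra A B))) /\
  (naturally_full (cofree A) -> naturally_full (cofree B) ->
     naturally_full (cofree (white_coalgebra A B))).
Proof.
case: varpi_split => s sK.
(* The retraction [s] cancels the [varpi] in the counit of the product, so both cases reduce to the
   two factors separately. *)
have chiE (a : hom (munit (black V)) A) (b : hom (munit (black V)) B) :
    (a ⊠[white V] b) \o s \o counit (white_coalgebra A B)
    = (a \o counit A) ⊠[white V] (b \o counit B).
  by rewrite /= -compA (compA s) sK comp_idl -tensm_comp.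
split.
  move=> /semiseparable_cofreeP [a ea] /semiseparable_cofreeP [b eb].
  apply/semiseparable_cofreeP; exists ((a ⊠[white V] b) \o s).
  by rewrite -compA chiE /= -compA -tensm_comp !compA ea eb.
move=> /naturally_full_cofreeP [a ea] /naturally_full_cofreeP [b eb].
apply/naturally_full_cofreeP; exists ((a ⊠[white V] b) \o s).
by rewrite chiE ea eb tensm_id.
Qed.
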